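(* Let $A\in\mathbb{R}^{n\times n}$, $B\in\mathbb{R}^{n\times m}$, $K\in\mathbb{R}^{m\times n}$, let $\rho>0$ and $\eta>0$, and let $P\in\mathbb{R}^{n\times n}$ be symmetric positive definite. For a map $\varphi:\mathbb{R}^m\times[0,\infty)\to\mathbb{R}^m$, continuous in its second argument, consider the Lur'e system $$\dot x = Ax + B\varphi(Kx,t).$$ This system is strongly infinitesimally contracting with respect to $\|\cdot\|_P$ with rate $\eta$ for every such $\varphi$ satisfying $$(\varphi(y_1,t)-\varphi(y_2,t))^\top(y_1-y_2)\ \ge\ \rho\,\|\varphi(y_1,t)-\varphi(y_2,t)\|_2^2\qquad\text{for all } y_1,y_2\in\mathbb{R}^m,\ t\ge 0,$$ if and only if there exists $\lambda\ge 0$ such that $$\begin{bmatrix} A^\top P+PA+2\eta P & PB+\lambda K^\top\\ B^\top P+\lambda K & -2\lambda\rho I_m\end{bmatrix}\preceq 0 .$$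
   Context: For a symmetric positive definite matrix $P$, $\|x\|_P:=\sqrt{x^\top P x}$; $\|\cdot\|_2$ is the Euclidean norm. A vector field $F:[0,\infty)\times\mathbb{R}^n\to\mathbb{R}^n$, $(t,x)\mapsto F(t,x)$, continuous in $t$ and Lipschitz in $x$, is called strongly infinitesimally contracting with respect to $\|\cdot\|_P$ with rate $c>0$ if for all $x_1,x_2\in\mathbb{R}^n$ and all $t\ge 0$, $$(F(t,x_1)-F(t,x_2))^\top P(x_1-x_2)\le -c\,\|x_1-x_2\|_P^2 .$$ A system $\dot x=F(t,x)$ is called contracting in this sense if its vector field is. The relation $M\preceq 0$ means that the symmetric matrix $M$ is negative semidefinite.
   Formalization: The ''only if'' direction is stated for K ≠ 0 only; it is false for K = 0 (n = m = 1, A = −1, B = P = ρ = η = 1: every such system contracts with rate 1, but the matrix inequality has no solution λ). The ''if'' direction holds for all K. *)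

(* Defs.v *)
From HB Require Import structures.
From mathcomp Require Import all_boot all_order all_algebra.
From mathcomp Require Import all_classical all_reals all_analysis.

Set Implicit Arguments.
Unset Strict Implicit.
Unset Printing Implicit Defensive.

Import Order.TTheory GRing.Theory Num.Theory.
Import numFieldNormedType.Exports.
Local Open Scope classical_set_scope.
Local Open Scope ring_scope.

Definition dotv (R : realType) (k : nat) (x y : 'cV[R]_k) : R :=
  (x^T *m y) 0 0.

(* The library norm on matrices is the max norm, hence these. *)
Definition norm2 (R : realType) (k : nat) (x : 'cV[R]_k) : R :=
  Num.sqrt (dotv x x).

Definition normP (R : realType) (k : nat) (P : 'M[R]_k) (x : 'cV[R]_k) : R :=
  Num.sqrt (dotv x (P *m x)).

Definition sym_posdef (R : realType) (k : nat) (P : 'M[R]_k) : Prop :=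
  P^T = P /\ forall x : 'cV[R]_k, x != 0 -> 0 < dotv x (P *m x).

Definition sym_negsemidef (R : realType) (k : nat) (M : 'M[R]_k) : Prop :=
  M^T = M /\ forall x : 'cV[R]_k, dotv x (M *m x) <= 0.

(* Functions of time on [0, +oo[ are total functions on R; only their values
   at t >= 0 are ever constrained. *)
Definition continuous_in_time (R : realType) (k : nat)
    (f : R -> 'cV[R]_k) : Prop :=
  {within `[0, +oo[, continuous f}.

(* The regularity assumed of a vector field is part of the definition. *)
Definition strongly_inf_contracting (R : realType) (n : nat)
    (P : 'M[R]_n) (c : R) (F : R -> 'cV[R]_n -> 'cV[R]_n) : Prop :=
  [/\ forall x : 'cV[R]_n, continuous_in_time (F ^~ x),
      forall t : R, 0 <= t -> lipschitz (F t)
    & forall (x1 x2 : 'cV[R]_n) (t : R), 0 <= t ->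
        dotv (F t x1 - F t x2) (P *m (x1 - x2))
          <= - c * normP P (x1 - x2) ^+ 2].

Definition lure_field (R : realType) (n m : nat)
    (A : 'M[R]_n) (B : 'M[R]_(n, m)) (K : 'M[R]_(m, n))
    (phi : 'cV[R]_m -> R -> 'cV[R]_m) : R -> 'cV[R]_n -> 'cV[R]_n :=
  fun t x => A *m x + B *m phi (K *m x) t.

Definition cocoercive (R : realType) (m : nat) (rho : R)
    (phi : 'cV[R]_m -> R -> 'cV[R]_m) : Prop :=
  forall (y1 y2 : 'cV[R]_m) (t : R), 0 <= t ->
    dotv (phi y1 t - phi y2 t) (y1 - y2)
      >= rho * norm2 (phi y1 t - phi y2 t) ^+ 2.

Definition lure_lmi_mx (R : realType) (n m : nat)
    (A : 'M[R]_n) (B : 'M[R]_(n, m)) (K : 'M[R]_(m, n))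
    (P : 'M[R]_n) (rho eta lambda : R) : 'M[R]_(n + m) :=
  block_mx (A^T *m P + P *m A + (2 * eta) *: P) (P *m B + lambda *: K^T)
           (B^T *m P + lambda *: K)             (- (2 * lambda * rho))%:M.

(* Main.v *)
Require Import Defs.
From mathcomp Require Import all_boot all_order all_algebra.
From mathcomp Require Import all_classical all_reals all_analysis.
From mathcomp Require Import ring lra.
Set Implicit Arguments.
Unset Strict Implicit.
Unset Printing Implicit Defensive.

Import Order.TTheory GRing.Theory Num.Theory.
Import numFieldNormedType.Exports.
Local Open Scope ring_scope.

(** For a difference [x] of two states and the corresponding difference [u] of
    two values of the nonlinearity, cocoercivity says that the quadratic form
    [g (x, u) = 2 (u . K x - rho |u|^2)] is nonnegative, and contraction says
    that [f (x, u) = 2 ((A x + B u) . P x + eta x . P x)] is nonpositive.  The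
    quadratic form of the matrix in the inequality is [f + lambda g]
    ([lure_lmi_formE]).

    Sufficiency is then immediate: where [g >= 0], the inequality
    [f + lambda g <= 0] gives [f <= 0].  The regularity of the closed loop comes
    from the fact that a cocoercive map is Lipschitz
    ([cocoercive_lipschitz]).

    Necessity has two steps.  First, contraction for all cocoercive
    nonlinearities forces [f <= 0] wherever [g >= 0]
    ([cocoercivity_form_implies_lmi_form]): every pair [(x, u)] with
    [g (x, u) >= 0] is realized by the rank-one linear map
    [y |-> (u . y / u . K x) u], which is cocoercive and sends [K x] to [u].
    Second, the S-lemma ([s_lemma]) turns the implication
    [g >= 0 -> f <= 0] into a multiplier [lambda >= 0].  It requires a point
    where [g > 0]; such a point exists because [K != 0], whereas [K = 0] would
    make [g = - 2 rho |u|^2] nonpositive. *)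

(** * Bilinear algebra of the dot product *)

Section DotProduct.
Context {R : realType}.

Lemma dotvE k (x y : 'cV[R]_k) : dotv x y = \sum_i x i 0 * y i 0.
Proof. by rewrite /dotv mxE; apply: eq_bigr => i _; rewrite mxE. Qed.

Lemma dotvC k (x y : 'cV[R]_k) : dotv x y = dotv y x.
Proof. by rewrite !dotvE; apply: eq_bigr => i _; exact: mulrC. Qed.

Lemma dotvDr k (x y z : 'cV[R]_k) : dotv x (y + z) = dotv x y + dotv x z.
Proof. by rewrite /dotv mulmxDr mxE. Qed.

Lemma dotvZr k a (x y : 'cV[R]_k) : dotv x (a *: y) = a * dotv x y.
Proof. by rewrite /dotv -scalemxAr mxE. Qed.

Lemma dotvBr k (x y z : 'cV[R]_k) : dotv x (y - z) = dotv x y - dotv x z.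
Proof. by rewrite -scaleN1r dotvDr dotvZr mulN1r. Qed.

Lemma dotvDl k (x y z : 'cV[R]_k) : dotv (y + z) x = dotv y x + dotv z x.
Proof. by rewrite dotvC dotvDr !(dotvC x). Qed.

Lemma dotvZl k a (x y : 'cV[R]_k) : dotv (a *: x) y = a * dotv x y.
Proof. by rewrite dotvC dotvZr dotvC. Qed.

Lemma dotv0l k (x : 'cV[R]_k) : dotv 0 x = 0.
Proof. by rewrite /dotv trmx0 mul0mx mxE. Qed.

Lemma dotv_trmx k l (M : 'M[R]_(k, l)) x y :
  dotv x (M *m y) = dotv (M^T *m x) y.
Proof. by rewrite /dotv trmx_mul trmxK mulmxA. Qed.

Lemma dotv_col_mx k l (x x' : 'cV[R]_k) (y y' : 'cV[R]_l) :
  dotv (col_mx x y) (col_mx x' y') = dotv x x' + dotv y y'.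
Proof. by rewrite /dotv tr_col_mx mul_row_col mxE. Qed.

Lemma dotv_ge0 k (x : 'cV[R]_k) : 0 <= dotv x x.
Proof. by rewrite dotvE; apply: sumr_ge0 => i _; rewrite -expr2 sqr_ge0. Qed.

Lemma dotv_gt0 k (x : 'cV[R]_k) : x != 0 -> 0 < dotv x x.
Proof.
move=> x0; rewrite lt_neqAle dotv_ge0 andbT eq_sym; apply: contra x0.
rewrite dotvE psumr_eq0 => [/allP x0|i _]; last by rewrite -expr2 sqr_ge0.
apply/eqP/matrixP => i j; rewrite ord1 mxE; apply/eqP.
by have := x0 i (mem_index_enum _); rewrite /= mulf_eq0 orbb.
Qed.

Lemma norm2_sqr k (x : 'cV[R]_k) : norm2 x ^+ 2 = dotv x x.
Proof. exact/sqr_sqrtr/dotv_ge0. Qed.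

Lemma normP_sqr k (P : 'M[R]_k) (x : 'cV[R]_k) :
  sym_posdef P -> normP P x ^+ 2 = dotv x (P *m x).
Proof.
move=> [_ P_gt0]; apply: sqr_sqrtr; have [->|/P_gt0/ltW//] := eqVneq x 0.
by rewrite dotv0l.
Qed.

Lemma dotv_line k (M : 'M[R]_k) z w t :
  dotv (z + t *: w) (M *m (z + t *: w)) =
  dotv z (M *m z) + t * (dotv z (M *m w) + dotv w (M *m z))
  + t ^+ 2 * dotv w (M *m w).
Proof. by rewrite mulmxDr -scalemxAr !(dotvDl, dotvDr, dotvZl, dotvZr); ring. Qed.

End DotProduct.

(** * Max-norm estimates *)

Section MaxNorm.
Context {R : realType}.

Lemma entry_le_norm k (x : 'cV[R]_k) i : `|x i 0| <= `|x|.
Proof.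
by rewrite [leRHS]/Num.Def.normr /= mx_normrE (le_bigmax _ _ (i, 0)).
Qed.

Lemma norm_le_entries k (x : 'cV[R]_k) c :
  0 <= c -> (forall i, `|x i 0| <= c) -> `|x| <= c.
Proof.
move=> c0 xc; rewrite [leLHS]/Num.Def.normr /= mx_normrE;
apply: bigmax_le => //= -[i j] _.
by rewrite ord1.
Qed.

(** With [dotv_le_norm], this compares the Euclidean structure with the max
    norm, in which Lipschitz continuity is stated. *)
Lemma sqr_norm_le_dotv k (x : 'cV[R]_k) : `|x| ^+ 2 <= dotv x x.
Proof.
rewrite -(sqr_sqrtr (dotv_ge0 _)) ler_sqr ?nnegrE ?sqrtr_ge0 ?normr_ge0//.
apply: norm_le_entries => [|i]; first exact: sqrtr_ge0.
rewrite -sqrtr_sqr ler_sqrt ?dotv_ge0// dotvE (bigD1 i)//= expr2 lerDl.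
by apply: sumr_ge0 => j _; rewrite -expr2 sqr_ge0.
Qed.

Lemma dotv_le_norm k (x y : 'cV[R]_k) : dotv x y <= k%:R * (`|x| * `|y|).
Proof.
rewrite dotvE mulr_natl -[X in _ *+ X]card_ord -sumr_const; apply: ler_sum => i _.
by rewrite (le_trans (ler_norm _))// normrM ler_pM ?entry_le_norm.
Qed.

Lemma mulmx_bounded k l (M : 'M[R]_(k, l)) :
  exists2 c, 0 <= c & forall x : 'cV[R]_l, `|M *m x| <= c * `|x|.
Proof.
exists (\sum_i \sum_j `|M i j|) => [|x].
  by do 2![apply: sumr_ge0 => ? _].
apply: norm_le_entries => [|i].
  by apply: mulr_ge0 => //; do 2![apply: sumr_ge0 => ? _].
rewrite mxE (le_trans (ler_norm_sum _ _ _))// mulr_suml (bigD1 i)//=.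
rewrite ler_wpDr//.
  by apply: sumr_ge0 => ? _; apply: mulr_ge0 => //; apply: sumr_ge0.
by rewrite mulr_suml ler_sum// => j _; rewrite normrM ler_wpM2l// entry_le_norm.
Qed.

Lemma mulmx_continuous k l (M : 'M[R]_(k, l)) :
  continuous (mulmx M : 'cV[R]_l -> 'cV[R]_k).
Proof.
apply: bounded_linear_continuous; apply/bounded_funP => r.
have [c c0 Mc] := mulmx_bounded M.
by exists (c * r) => x xr; rewrite (le_trans (Mc x))// ler_wpM2l.
Qed.

End MaxNorm.

(** * The S-lemma *)

Section SLemma.
Context {R : realType}.

(** The discriminant [b^2 + 4 p r] exceeds [b^2], so the two roots have opposite
    signs.  In [s_lemma_cross] the polynomial is the restriction of a quadratic
    form to a line along which the form changes sign; that proof uses the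
    product of the roots. *)
Lemma sign_change_roots (p b r : R) : 0 < p -> 0 < r ->
  exists t1 t2, [/\ t1 < 0, 0 < t2, r * (t1 * t2) = - p,
    p + t1 * b - t1 ^+ 2 * r = 0 & p + t2 * b - t2 ^+ 2 * r = 0].
Proof.
move=> p0 r0; set d := Num.sqrt (b ^+ 2 + 4 * p * r).
have dE : d ^+ 2 = b ^+ 2 + 4 * p * r.
  by apply: sqr_sqrtr; rewrite addr_ge0 ?sqr_ge0// !mulr_ge0 ?ltW.
have rN0 : r != 0 by rewrite gt_eqF.
have bd : `|b| < d.
  rewrite -sqrtr_sqr ltr_sqrt ?ltrDl ?ltr_wpDl ?sqr_ge0 ?mulr_gt0//.
have [b1 b2] : - d < b /\ b < d by apply/andP; rewrite -ltr_norml.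
exists ((b - d) / (2 * r)), ((b + d) / (2 * r)); split.
- by rewrite pmulr_llt0 ?invr_gt0 ?mulr_gt0// subr_lt0.
- by rewrite divr_gt0 ?mulr_gt0//; lra.
- have -> : r * ((b - d) / (2 * r) * ((b + d) / (2 * r))) =
    (b ^+ 2 - d ^+ 2) / (4 * r) by field.
  by rewrite dE; field.
- have -> : p + (b - d) / (2 * r) * b - ((b - d) / (2 * r)) ^+ 2 * r =
    p + (b ^+ 2 - d ^+ 2) / (4 * r) by field.
  by rewrite dE; field.
- have -> : p + (b + d) / (2 * r) * b - ((b + d) / (2 * r)) ^+ 2 * r =
    p + (b ^+ 2 - d ^+ 2) / (4 * r) by field.
  by rewrite dE; field.
Qed.

(** The compatibility of the lower and upper bounds that [w] and [z] impose on
    the multiplier.  Write [f] and [g] for the forms of [F] and [G].  The line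
    [z + t w] meets the null cone of [g] at [t1 < 0 < t2]; there [f] is
    nonpositive.  The combination of the two inequalities with weights [t2] and
    [- t1] cancels the cross term and leaves [f z - t1 t2 f w <= 0], where
    [- t1 t2] is the ratio of [g z] to [- g w]. *)
Lemma s_lemma_cross k (F G : 'M[R]_k) z w :
  (forall v, 0 <= dotv v (G *m v) -> dotv v (F *m v) <= 0) ->
  0 < dotv z (G *m z) -> dotv w (G *m w) < 0 ->
  dotv z (G *m z) * dotv w (F *m w) <= dotv w (G *m w) * dotv z (F *m z).
Proof.
move=> GF gz gw; have gw' : 0 < - dotv w (G *m w) by rewrite oppr_gt0.
have [t1 [t2 [t1_lt0 t2_gt0 tt g1 g2]]] :=
  sign_change_roots (dotv z (G *m w) + dotv w (G *m z)) gz gw'.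
have f1 : dotv (z + t1 *: w) (F *m (z + t1 *: w)) <= 0.
  by apply: GF; rewrite dotv_line; move: g1; lra.
have f2 : dotv (z + t2 *: w) (F *m (z + t2 *: w)) <= 0.
  by apply: GF; rewrite dotv_line; move: g2; lra.
move: f1 f2; rewrite !dotv_line.
set fz := dotv z (F *m z); set fw := dotv w (F *m w).
set c := dotv z (F *m w) + _ => f1 f2.
have : (t2 - t1) * (fz - t1 * t2 * fw) <= 0.
  have := mulr_ge0_le0 (ltW t2_gt0) f1.
  have t1' : 0 <= - t1 by rewrite oppr_ge0 ltW.
  have := mulr_ge0_le0 t1' f2.
  lra.
rewrite pmulr_rle0 => [f0|]; last by lra.
have := mulr_ge0_le0 (ltW gw') f0.
rewrite mulrBr mulrA tt; lra.
Qed.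

(** With [f] and [g] the forms of [F] and [G], a point [w] with [g w < 0]
    demands [lambda >= f w / - g w], and a point [z] with [g z > 0] demands
    [lambda <= - f z / g z].  By [s_lemma_cross] every lower bound is below
    every upper bound, so the supremum of the lower bounds satisfies all
    demands; the point where [g > 0] makes it finite. *)
Lemma s_lemma k (F G : 'M[R]_k) :
  (forall z, 0 <= dotv z (G *m z) -> dotv z (F *m z) <= 0) ->
  (exists z, 0 < dotv z (G *m z)) ->
  exists2 lambda, 0 <= lambda &
    forall z, dotv z (F *m z) + lambda * dotv z (G *m z) <= 0.
Proof.
move=> GF [z0 gz0].
pose E := [set l | l = 0 \/ exists2 w, dotv w (G *m w) < 0 &
                        l = dotv w (F *m w) / - dotv w (G *m w)]%classic.
(* The value 0 is put among the lower bounds to make the supremum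
   nonnegative and its set nonempty. *)
have E0 : E 0 by left.
have Eub z : 0 < dotv z (G *m z) ->
    ubound E (- dotv z (F *m z) / dotv z (G *m z)).
  move=> gz _ [->|[w gw ->]].
    by apply: divr_ge0; [rewrite oppr_ge0; apply: GF|]; exact: ltW.
  rewrite ler_pdivrMr ?oppr_gt0// mulrAC ler_pdivlMr//.
  by have := s_lemma_cross GF gz gw; lra.
have supE : has_ubound E by eexists; exact: Eub gz0.
exists (sup E) => [|z]; first exact: ub_le_sup.
have [gz|gz|gz] := ltrgt0P (dotv z (G *m z)).
- have : sup E <= - dotv z (F *m z) / dotv z (G *m z).
    by apply: ge_sup; [exists 0|exact: Eub].
  by rewrite ler_pdivlMr//; lra.
- have : dotv z (F *m z) / - dotv z (G *m z) <= sup E.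
    by apply: ub_le_sup => //; right; exists z.
  by rewrite ler_pdivrMr ?oppr_gt0//; lra.
- by rewrite gz mulr0 addr0 GF ?gz.
Qed.

End SLemma.

(** * The Lur'e system *)

Section Lure.
Context {R : realType} {n m : nat}.
Variables (A : 'M[R]_n) (B : 'M[R]_(n, m)) (K : 'M[R]_(m, n)).
Implicit Types (rho eta lambda t : R)
  (P : 'M[R]_n) (phi : 'cV[R]_m -> R -> 'cV[R]_m).

Definition cocoercivity_mx rho : 'M[R]_(n + m) :=
  block_mx 0 K^T K (- (2 * rho))%:M.

Lemma cocoercivity_formE rho x u :
  dotv (col_mx x u) (cocoercivity_mx rho *m col_mx x u) =
  2 * (dotv u (K *m x) - rho * dotv u u).
Proof.
rewrite mul_block_col mul0mx add0r mul_scalar_mx dotv_col_mx.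
rewrite dotvDr dotvZr dotv_trmx trmxK (dotvC (K *m x)); lra.
Qed.

Lemma lure_lmi_mxD P rho eta lambda :
  lure_lmi_mx A B K P rho eta lambda =
  lure_lmi_mx A B K P rho eta 0 + lambda *: cocoercivity_mx rho.
Proof.
rewrite /lure_lmi_mx /cocoercivity_mx scale_block_mx add_block_mx.
rewrite !scale0r !addr0 scaler0 addr0 scale_scalar_mx -raddfD /=.
by congr (block_mx _ _ _ _%:M); ring.
Qed.

Lemma lure_lmi_formE P rho eta lambda x u : P^T = P ->
  dotv (col_mx x u) (lure_lmi_mx A B K P rho eta lambda *m col_mx x u) =
  2 * (dotv (A *m x + B *m u) (P *m x) + eta * dotv x (P *m x))
  + lambda * (2 * (dotv u (K *m x) - rho * dotv u u)).
Proof.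
move=> PT; rewrite lure_lmi_mxD mulmxDl -scalemxAl dotvDr dotvZr.
rewrite cocoercivity_formE; congr (_ + _).
rewrite mul_block_col !mulmxDl -scalemxAl mul_scalar_mx -!mulmxA dotv_col_mx.
rewrite !scale0r !mul0mx !addr0 mulr0 mul0r oppr0 scale0r addr0.
rewrite !(dotvDl, dotvDr, dotvZr).
rewrite (dotv_trmx A^T) (dotv_trmx B^T) !trmxK !(dotv_trmx P x) PT.
rewrite (dotvC (P *m x) (A *m x)) (dotvC (P *m x) (B *m u)); lra.
Qed.

Lemma lure_lmi_mx_sym P rho eta lambda : P^T = P ->
  (lure_lmi_mx A B K P rho eta lambda)^T = lure_lmi_mx A B K P rho eta lambda.
Proof.
move=> PT; rewrite /lure_lmi_mx tr_block_mx tr_scalar_mx.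
have trmxZ k l a (M : 'M[R]_(k, l)) : (a *: M)^T = a *: M^T by exact: linearZ.
by rewrite !linearD /= !trmxZ !trmx_mul !trmxK PT [P *m A + _]addrC.
Qed.

Lemma lure_field_sub phi t x1 x2 :
  lure_field A B K phi t x1 - lure_field A B K phi t x2 =
  A *m (x1 - x2) + B *m (phi (K *m x1) t - phi (K *m x2) t).
Proof. by rewrite /lure_field !mulmxBr opprD addrACA. Qed.

(** Cocoercivity gives [rho |u|^2 <= u . y] for the differences [u] and [y] of
    the values and the arguments, and one factor [|u|] cancels.  The factor [m]
    is the cost of replacing the Euclidean norm by the max norm. *)
Lemma cocoercive_lipschitz rho phi t y1 y2 :
  0 < rho -> cocoercive rho phi -> 0 <= t ->
  `|phi y1 t - phi y2 t| <= m%:R / rho * `|y1 - y2|.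
Proof.
move=> rho0 phi_coco t0.
have := phi_coco y1 y2 t t0; rewrite norm2_sqr.
set u := phi y1 t - phi y2 t; set y := y1 - y2 => uy.
have [->|u0] := eqVneq `|u| 0; first by rewrite !mulr_ge0// invr_ge0 ltW.
have {}u0 : 0 < `|u| by rewrite lt_neqAle eq_sym u0 normr_ge0.
have : rho * `|u| ^+ 2 <= m%:R * (`|u| * `|y|).
  rewrite (le_trans _ (dotv_le_norm u y))// (le_trans _ uy)//.
  by rewrite ler_pM2l// sqr_norm_le_dotv.
by rewrite mulrAC ler_pdivlMr// => rho_u; rewrite -(ler_pM2l u0); lra.
Qed.

Lemma lure_field_continuous phi x :
  (forall y, continuous_in_time (phi y)) ->
  continuous_in_time (lure_field A B K phi ^~ x).
Proof.
move=> phi_cont t; apply: cvgD; first exact: cvg_cst.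
apply: (@continuous_comp _ _ _ _ (mulmx B)); first exact: phi_cont.
exact: mulmx_continuous.
Qed.

Lemma lure_field_lipschitz rho phi t :
  0 < rho -> cocoercive rho phi -> 0 <= t ->
  lipschitz (lure_field A B K phi t).
Proof.
move=> rho0 phi_coco t0.
have [a a0 aP] := mulmx_bounded A.
have [b b0 bP] := mulmx_bounded B.
have [k k0 kP] := mulmx_bounded K.
apply: (@klipschitzW _ _ _ (a + b * (m%:R / rho * k))).
  exact: (@globally_properfilter _ _ (0, 0)).
move=> [x1 x2] _ /=; rewrite lure_field_sub (le_trans (ler_normD _ _))//.
rewrite mulrDl lerD// (le_trans (bP _))// -!mulrA ler_wpM2l// mulrA.
rewrite (le_trans (cocoercive_lipschitz _ _ rho0 phi_coco t0))//.
by rewrite -mulmxBr ler_wpM2l // divr_ge0 // ltW.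
Qed.

Lemma lmi_contracting P rho eta lambda phi :
  0 < rho -> sym_posdef P -> 0 <= lambda ->
  sym_negsemidef (lure_lmi_mx A B K P rho eta lambda) ->
  (forall y, continuous_in_time (phi y)) -> cocoercive rho phi ->
  strongly_inf_contracting P eta (lure_field A B K phi).
Proof.
move=> rho0 Ppos lambda0 [_ lmi] phi_cont phi_coco; split.
- by move=> x; exact: lure_field_continuous.
- by move=> t t0; exact: lure_field_lipschitz phi_coco t0.
move=> x1 x2 t t0; rewrite lure_field_sub normP_sqr//.
have := phi_coco (K *m x1) (K *m x2) t t0.
rewrite norm2_sqr -mulmxBr.
set u := phi _ t - _; set x := x1 - x2 => uP.
have := lmi (col_mx x u); rewrite lure_lmi_formE; last by case: Ppos.
have : 0 <= lambda * (dotv u (K *m x) - rho * dotv u u).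
  by rewrite mulr_ge0// subr_ge0.
lra.
Qed.

(** The matrix [u u^T / (u . y0)], as a nonlinearity that is constant in time.
    If [u . y0 = 0], the division convention makes it the zero map. *)
Definition rank_one_feedback (u y0 : 'cV[R]_m) : 'cV[R]_m -> R -> 'cV[R]_m :=
  fun y _ => (dotv u y / dotv u y0) *: u.

(** With [c = u . y / u . y0], the two sides of cocoercivity at a difference [y]
    are [c^2 (u . y0)] and [rho c^2 |u|^2], so the condition at all [y] reduces
    to the condition at [y0]. *)
Lemma rank_one_feedback_cocoercive rho u y0 :
  0 < rho -> rho * dotv u u <= dotv u y0 ->
  cocoercive rho (rank_one_feedback u y0).
Proof.
move=> rho0 uy0 y1 y2 t _; rewrite norm2_sqr /rank_one_feedback -scalerBl.
have -> : dotv u y1 / dotv u y0 - dotv u y2 / dotv u y0 =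
    dotv u (y1 - y2) / dotv u y0.
  by rewrite -mulrBl dotvBr.
set c := _ / _; rewrite !dotvZl dotvZr.
have uy0_ge0 : 0 <= dotv u y0.
  by rewrite (le_trans _ uy0)// mulr_ge0 ?dotv_ge0 ?ltW.
have -> : c * dotv u (y1 - y2) = c * c * dotv u y0.
  rewrite /c; have [->|uy0N0] := eqVneq (dotv u y0) 0; last by field.
  by rewrite invr0 !(mulr0, mul0r).
by have := ler_wpM2l (sqr_ge0 c) uy0; lra.
Qed.

(** The hypothesis forces [u . y0 > 0] unless [u = 0], and in the latter case
    the zero map has the required value. *)
Lemma rank_one_feedbackK rho u y0 :
  0 < rho -> rho * dotv u u <= dotv u y0 -> rank_one_feedback u y0 y0 0 = u.
Proof.
move=> rho0 uy0; rewrite /rank_one_feedback.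
have [->|u0] := eqVneq u 0; first by rewrite scaler0.
rewrite divff ?scale1r// gt_eqF// (lt_le_trans _ uy0)//.
by rewrite mulr_gt0// dotv_gt0.
Qed.

Lemma cocoercivity_mx_pos rho : 0 < rho -> K != 0 ->
  exists z, 0 < dotv z (cocoercivity_mx rho *m z).
Proof.
move=> rho0 K0.
have [j Kj] : exists j, col j K != 0.
  apply/existsP; apply: contraNT K0; rewrite negb_exists => /forallP K0.
  apply/eqP/matrixP => i j; have := K0 j; rewrite negbK => /eqP/matrixP/(_ i 0).
  by rewrite !mxE.
(* For [y = K x] fixed, [u = y / (2 rho)] maximizes [u . y - rho |u|^2]. *)
exists (col_mx (delta_mx j 0) ((2 * rho)^-1 *: col j K)).
rewrite cocoercivity_formE -colE !dotvZl dotvZr.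
have -> : 2 * ((2 * rho)^-1 * dotv (col j K) (col j K) -
    rho * ((2 * rho)^-1 * ((2 * rho)^-1 * dotv (col j K) (col j K)))) =
    dotv (col j K) (col j K) / (2 * rho).
  by field; rewrite gt_eqF.
by rewrite divr_gt0 ?dotv_gt0 ?mulr_gt0.
Qed.

(** The contraction inequality, for the rank-one feedback that sends [K x] to
    [u] and [0] to [0], taken at the states [x] and [0], is the inequality for
    the pair [(x, u)]. *)
Lemma cocoercivity_form_implies_lmi_form P rho eta :
  0 < rho -> sym_posdef P ->
  (forall phi, (forall y, continuous_in_time (phi y)) -> cocoercive rho phi ->
    strongly_inf_contracting P eta (lure_field A B K phi)) ->
  forall z, 0 <= dotv z (cocoercivity_mx rho *m z) ->
    dotv z (lure_lmi_mx A B K P rho eta 0 *m z) <= 0.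
Proof.
move=> rho0 Ppos contr z; rewrite -[z]vsubmxK.
set x := usubmx z; set u := dsubmx z.
rewrite cocoercivity_formE lure_lmi_formE; last by case: Ppos.
rewrite pmulr_rge0// subr_ge0 mul0r addr0 pmulr_rle0// => uKx.
have phi_cont y : continuous_in_time (rank_one_feedback u (K *m x) y).
  by apply: continuous_subspaceT => t; exact: cvg_cst.
have [_ _ /(_ x 0 0 (lexx _))] :=
  contr _ phi_cont (rank_one_feedback_cocoercive rho0 uKx).
rewrite lure_field_sub subr0 (rank_one_feedbackK rho0 uKx) mulmx0.
rewrite /rank_one_feedback [dotv u 0]dotvC dotv0l mul0r scale0r subr0.
by rewrite normP_sqr//; lra.
Qed.

End Lure.

Theorem theorem1 (R : realType) (n m : nat)
    (A : 'M[R]_n) (B : 'M[R]_(n, m)) (K : 'M[R]_(m, n))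
    (rho eta : R) (P : 'M[R]_n)
    (hrho : 0 < rho) (heta : 0 < eta) (hP : sym_posdef P) :
  ((exists lambda : R,
      0 <= lambda /\ sym_negsemidef (lure_lmi_mx A B K P rho eta lambda)) ->
    forall phi : 'cV[R]_m -> R -> 'cV[R]_m,
      (forall y : 'cV[R]_m, continuous_in_time (phi y)) ->
      cocoercive rho phi ->
      strongly_inf_contracting P eta (lure_field A B K phi))
  /\
  (K != 0 ->
    (forall phi : 'cV[R]_m -> R -> 'cV[R]_m,
      (forall y : 'cV[R]_m, continuous_in_time (phi y)) ->
      cocoercive rho phi ->
      strongly_inf_contracting P eta (lure_field A B K phi)) ->
    exists lambda : R,
      0 <= lambda /\ sym_negsemidef (lure_lmi_mx A B K P rho eta lambda)).
Proof.
split=> [[lambda [lambda0 lmi]] phi phi_cont phi_coco|K0 contr].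
  exact: lmi_contracting hrho hP lambda0 lmi phi_cont phi_coco.
have [lambda lambda0 lmi] := s_lemma
  (cocoercivity_form_implies_lmi_form hrho hP contr)
  (cocoercivity_mx_pos hrho K0).
exists lambda; split=> //; split=> [|z].
  by apply: lure_lmi_mx_sym; case: hP.
by rewrite lure_lmi_mxD mulmxDl -scalemxAl dotvDr dotvZr.
Qed.
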